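(* Let $n$ be a positive integer. If $N=2n$, then $$\bigg(\prod_{k=1}^n S\,j^{2k-1}\,s\,J^{2k}\bigg)\bigg(\prod_{k=1}^n s\,j^{2n-2k+1}\,S\,J^{2n-2k}\bigg)$$ is a sequence of $N^2+2N$ moves that solves the peg puzzle with parameter $N$. If $N=2n-1$, then $$\bigg(\prod_{k=1}^{n-1}S\,j^{2k-1}\,s\,J^{2k}\bigg)\,S\,j^{2n-1}\,S\,\bigg(\prod_{k=1}^{n-1}J^{2n-2k}\,s\,j^{2n-2k-1}\,S\bigg)$$ is likewise a sequence of $N^2+2N$ moves that solves the peg puzzle with parameter $N$.
   Context: The peg puzzle. Let $N$ be a positive integer. The apparatus consists of $N$ red pegs, $N$ blue pegs, and a block with a single row of $2N+1$ equally spaced holes, each hole containing at most one peg. Initially the $N$ blue pegs occupy the leftmost $N$ holes, the $N$ red pegs occupy the rightmost $N$ holes, and the center hole is empty. The goal is to reach the position in which the red pegs occupy the leftmost $N$ holes, the blue pegs occupy the rightmost $N$ holes (and the center hole is empty). Allowable moves are of two types: a step, in which one peg moves from an occupied hole into the adjacent (unique) empty hole; and a jump, in which one peg jumps over a single adjacent peg (of either color) into the empty hole on the other side of that peg. Steps and jumps may be made in either direction by pegs of either color. A sequence of moves solves the puzzle if each move is allowable in the position in which it is made and the sequence takes the initial position to the goal position. Notation for moves: $S$ denotes a step to the right made by a blue peg; $s$ denotes a step to the left made by a red peg; $J$ denotes a jump to the right made by a blue peg; $j$ denotes a jump to the left made by a red peg. Since there is only one empty hole, each symbol determines at most one move in any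 given position. A word in these symbols denotes the sequence of moves performed in order from left to right; $J^m$ (resp. $j^m$) denotes $m$ consecutive moves $J$ (resp. $j$), with $m=0$ giving the empty word; products denote concatenation, with $\prod_{k=a}^{b}$ concatenating the factors from left to right in order of increasing $k$, and an empty product being the empty word. *)

(* Defs.v *)
From mathcomp Require Import all_boot.
Set Implicit Arguments.
Unset Strict Implicit.
Unset Printing Implicit Defensive.

Inductive colour := Blue | Red.

Inductive direction := Leftward | Rightward.

Inductive move :=
  | Step of colour & direction
  | Jump of colour & direction.

(* Holes are numbered from left to right; [None] is an empty hole. *)
Definition position (N : nat) := {ffun 'I_(2 * N).+1 -> option colour}.

Definition initial (N : nat) : position N :=
  [ffun i : 'I_(2 * N).+1 =>
     if i < N then Some Blue else if val i == N then None else Some Red].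

Definition goal (N : nat) : position N :=
  [ffun i : 'I_(2 * N).+1 =>
     if i < N then Some Red else if val i == N then None else Some Blue].

(* The hole adjacent to [i] on the side [d] is [i']. *)
Definition adjacent (N : nat) (d : direction) (i i' : 'I_(2 * N).+1) : Prop :=
  match d with
  | Leftward => val i = (val i').+1
  | Rightward => val i' = (val i).+1
  end.

Definition relocate (N : nat) (p : position N) (i i' : 'I_(2 * N).+1) :
    position N :=
  [ffun k => if k == i then None else if k == i' then p i else p k].

(* [m] is allowable in [p] and turns it into [q]. Every position reachable from
   [initial N] has exactly one empty hole, so there [q] is determined by [m] and
   [p]. *)
Definition performs (N : nat) (m : move) (p q : position N) : Prop :=
  match m with
  | Step c d => exists i i' : 'I_(2 * N).+1,
      [/\ adjacent d i i', p i = Some c, p i' = None & q = relocate p i i']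
  | Jump c d => exists i h i' : 'I_(2 * N).+1,
      adjacent d i h /\ adjacent d h i' /\
      [/\ p i = Some c, p h <> None, p i' = None & q = relocate p i i']
  end.

Fixpoint leads (N : nat) (w : seq move) (p q : position N) : Prop :=
  match w with
  | [::] => p = q
  | m :: w' => exists r : position N, performs m p r /\ leads w' r q
  end.

Definition solves (N : nat) (w : seq move) : Prop :=
  leads w (initial N) (goal N).

Definition move_S : move := Step Blue Rightward.
Definition move_s : move := Step Red Leftward.
Definition move_J : move := Jump Blue Rightward.
Definition move_j : move := Jump Red Leftward.

(* Main.v *)
Require Import Defs.
From mathcomp Require Import all_boot.
From mathcomp Require Import zify.

(** The solution first shuffles the two colours into one another and then sorts
    them out again.  Write B, R for the pegs, _ for the hole, and (RB)^m for m
    adjacent pairs RB.  After k rounds of the first phase the row is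
      B^(N-2k) _ (RB)^(2k) R^(N-2k),
    so the alternating block has absorbed 2k pegs of each colour.  The second
    phase passes through the rows R^a _ (RB)^m B^a with a + m = N, the block
    shrinking to nothing while the pegs it sheds pile up at their goal.

    Everything happens at the ends of the alternating block.  A single step
    there moves the hole past one peg and thereby shifts by one the way the
    block splits into pairs: what was read as RB RB ... is now read as
    BR BR ..., with the hole next to it.  In that reading consecutive jumps
    carry the hole through the whole block, each one exchanging a pair BR into
    RB ([play_jumps_j], [play_jumps_J]), and the hole emerges at the other end.
    A step followed by such a run of jumps is a half-round.  It lengthens or
    shortens the block by one pair according as the stepping peg joins the
    block or leaves it: lemmas
    [extend_Sj], [extend_sJ], [shorten_sj], [shorten_SJ].  The phases
    ([interleave], [separate_even], [separate_odd]) iterate these.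

    When N is odd, the first phase stops at B _ (RB)^(N-1) R, and the half-round
    S j^N brings all pegs into the block, giving (RB)^N _.  From there the
    block shrinks as in the even case, but the hole is now at the right end, so
    that a round of the second phase starts with the other half-round.

    The number of moves follows by pairing the k-th round of one phase with the
    k-th round of the other: the total does not depend on k. *)

Local Notation B := (Some Blue).
Local Notation R := (Some Red).
Local Notation cell := (option colour).

(** * Rows of holes as lists *)

Definition layout (N : nat) (s : seq cell) : position N :=
  [ffun i : 'I_(2 * N).+1 => nth None s i].

(** Having the length of the row both as a premise and in the conclusion lets
    plays be composed without side conditions on sizes. *)
Definition plays (w : seq move) (s t : seq cell) : Prop :=
  forall N, size s = (2 * N).+1 ->
    size t = (2 * N).+1 /\ leads w (layout N s) (layout N t).

Lemma leads_cat N w1 w2 (p q r : position N) :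
  leads w1 p q -> leads w2 q r -> leads (w1 ++ w2) p r.
Proof.
elim: w1 p => [|m w1 IH] p /=; first by move=> ->.
by move=> [p' [mp w1p']] w2q; exists p'; split=> //; apply: IH w2q.
Qed.

Lemma plays_nil s : plays [::] s s.
Proof. by move=> N sz. Qed.

Lemma plays_cat w1 w2 s t u :
  plays w1 s t -> plays w2 t u -> plays (w1 ++ w2) s u.
Proof.
move=> h1 h2 N /h1 [/h2 [szu l2] l1]; split=> //; exact: leads_cat l1 l2.
Qed.

Lemma plays_big W (P : nat -> seq cell) a b :
  a <= b -> (forall k, a <= k < b -> plays (W k) (P k) (P k.+1)) ->
  plays (\big[cat/[::]]_(a <= k < b) W k) (P a) (P b).
Proof.
elim: b => [|b IH] ab round.
  by move: ab; rewrite leqn0 => /eqP->; rewrite big_geq //; exact: plays_nil.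
move: ab; rewrite leq_eqVlt => /orP[/eqP->|ab].
  by rewrite big_geq //; exact: plays_nil.
rewrite big_nat_recr //=; apply: plays_cat (round b _); last by rewrite -ltnS ab /=.
apply: IH => // k /andP[ak kb]; apply: round; rewrite ak /=; exact: ltnW.
Qed.

Lemma plays_move m s t :
  size t = size s ->
  (forall N, size s = (2 * N).+1 -> performs m (layout N s) (layout N t)) ->
  plays [:: m] s t.
Proof.
move=> szt mP N sz; split; first by rewrite szt.
by exists (layout N t); split=> //; apply: mP.
Qed.

Lemma layout_relocate N s t (i i' : 'I_(2 * N).+1) :
  (forall k, nth None t k =
     if k == i then None else if k == i' then nth None s i else nth None s k) ->
  layout N t = relocate (layout N s) i i'.
Proof. by move=> tE; apply/ffunP=> k; rewrite !ffunE tE. Qed.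

Lemma nth_prefix (u s : seq cell) d : nth None (u ++ s) (size u + d) = nth None s d.
Proof. by rewrite nth_cat ltnNge leq_addr /= addKn. Qed.

(** A move changes at most three neighbouring holes; taking [u] to be everything to
    their left, [d] and [d'] become numerals and the premise on [k] is settled by
    a finite case distinction. *)
Lemma layout_relocate_prefix N u s t (i i' : 'I_(2 * N).+1) d d' :
  val i = size u + d -> val i' = size u + d' ->
  (forall k, nth None t k =
     if k == d then None else if k == d' then nth None s d else nth None s k) ->
  layout N (u ++ t) = relocate (layout N (u ++ s)) i i'.
Proof.
move=> /= iE i'E tE; apply: layout_relocate => k.
rewrite iE i'E nth_prefix; have [ku|uk] := ltnP k (size u).
  by rewrite !nth_cat ku !ltn_eqF // ltn_addr.
by rewrite -(subnKC uk) !nth_prefix !eqn_add2l tE.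
Qed.

Lemma play_S u v : plays [:: move_S] (u ++ B :: None :: v) (u ++ None :: B :: v).
Proof.
apply: plays_move => [|N]; rewrite !size_cat //= => sz.
have i0 : size u + 0 < (2 * N).+1 by lia.
have i1 : size u + 1 < (2 * N).+1 by lia.
exists (Ordinal i0), (Ordinal i1); rewrite /= !ffunE /= !nth_prefix; split=> //; first lia.
by apply: layout_relocate_prefix => //; case=> [|[|k]].
Qed.

Lemma play_s u v : plays [:: move_s] (u ++ None :: R :: v) (u ++ R :: None :: v).
Proof.
apply: plays_move => [|N]; rewrite !size_cat //= => sz.
have i0 : size u + 0 < (2 * N).+1 by lia.
have i1 : size u + 1 < (2 * N).+1 by lia.
exists (Ordinal i1), (Ordinal i0); rewrite /= !ffunE /= !nth_prefix; split=> //; first lia.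
by apply: layout_relocate_prefix => //; case=> [|[|k]].
Qed.

Lemma play_J c u v :
  plays [:: move_J] (u ++ B :: Some c :: None :: v) (u ++ None :: Some c :: B :: v).
Proof.
apply: plays_move => [|N]; rewrite !size_cat //= => sz.
have i0 : size u + 0 < (2 * N).+1 by lia.
have i1 : size u + 1 < (2 * N).+1 by lia.
have i2 : size u + 2 < (2 * N).+1 by lia.
exists (Ordinal i0), (Ordinal i1), (Ordinal i2); rewrite /= !ffunE /= !nth_prefix.
do 2![split; first lia]; split=> //.
by apply: layout_relocate_prefix => //; case=> [|[|[|k]]].
Qed.

Lemma play_j c u v :
  plays [:: move_j] (u ++ None :: Some c :: R :: v) (u ++ R :: Some c :: None :: v).
Proof.
apply: plays_move => [|N]; rewrite !size_cat //= => sz.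
have i0 : size u + 0 < (2 * N).+1 by lia.
have i1 : size u + 1 < (2 * N).+1 by lia.
have i2 : size u + 2 < (2 * N).+1 by lia.
exists (Ordinal i2), (Ordinal i1), (Ordinal i0); rewrite /= !ffunE /= !nth_prefix.
do 2![split; first lia]; split=> //.
by apply: layout_relocate_prefix => //; case=> [|[|[|k]]].
Qed.

(** * Runs of jumps through an alternating block *)

Definition alt (x y : cell) q : seq cell := flatten (nseq q [:: x; y]).

(** An alternating row of odd length splits into pairs once either of its end pegs
    is set aside; all changes of viewpoint between BRBR... and RBRB... rest on
    this. *)
Lemma alt_rotate x y q : alt x y q ++ [:: x] = x :: alt y x q.
Proof. by elim: q => //= q ->. Qed.

Lemma alt_rotate_cat x y q v : alt x y q ++ x :: v = x :: alt y x q ++ v.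
Proof. by rewrite -cat1s catA alt_rotate. Qed.

Lemma alt_rcons x y q v : alt x y q.+1 ++ v = alt x y q ++ x :: y :: v.
Proof. by rewrite !alt_rotate_cat /= -alt_rotate_cat. Qed.

(** Each jump moves the hole two places to the right, over one pair BR, which
    becomes the pair RB to the left of the hole. *)
Lemma play_jumps_j q u v :
  plays (nseq q move_j) (u ++ None :: alt B R q ++ v) (u ++ alt R B q ++ None :: v).
Proof.
elim: q u => [|q IH] u; first exact: plays_nil.
rewrite -[nseq _ _]/([:: move_j] ++ nseq q move_j).
apply: plays_cat (play_j Blue _ _) _.
by have := IH (u ++ [:: R; B]); rewrite -!catA.
Qed.

(** The hole now moves to the left, so the last pair of the block is the first to
    be exchanged; a pair BR again becomes RB, because both kinds of jump carry
    blue to the right and red to the left. *)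
Lemma play_jumps_J q u v :
  plays (nseq q move_J) (u ++ alt B R q ++ None :: v) (u ++ None :: alt R B q ++ v).
Proof.
elim: q v => [|q IH] v; first exact: plays_nil.
rewrite -[nseq _ _]/([:: move_J] ++ nseq q move_J).
rewrite alt_rcons catA; apply: plays_cat (play_J Red _ _) _.
by rewrite -catA alt_rcons; exact: IH.
Qed.

(** * Half-rounds *)

(** The step brings a blue peg to the left end of the block; together with the red
    peg [R] to the right of the block this gives m+1 pairs BR, which the hole then
    traverses. *)
Lemma extend_Sj m u v :
  plays ([:: move_S] ++ nseq m.+1 move_j)
    (u ++ B :: None :: alt R B m ++ R :: v) (u ++ alt R B m.+1 ++ None :: v).
Proof.
apply: plays_cat (play_S _ _) _.
by rewrite alt_rotate_cat; exact: (play_jumps_j m.+1).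
Qed.

Lemma extend_sJ m u v :
  plays ([:: move_s] ++ nseq m.+1 move_J)
    (u ++ B :: alt R B m ++ None :: R :: v) (u ++ None :: alt R B m.+1 ++ v).
Proof.
have -> : u ++ B :: alt R B m ++ None :: R :: v =
          (u ++ B :: alt R B m) ++ None :: R :: v by rewrite -catA.
apply: plays_cat (play_s _ _) _.
rewrite -catA /= alt_rotate_cat; exact: (play_jumps_J m.+1).
Qed.

(** The last peg B of the block leaves it on the right; the first peg R is left
    over on the other side, once the remaining pegs are paired as BR. *)
Lemma shorten_S m u v :
  plays [:: move_S]
    (u ++ alt R B m.+1 ++ None :: v) (u ++ R :: alt B R m ++ None :: B :: v).
Proof.
rewrite alt_rcons -alt_rotate_cat.
by have := play_S (u ++ alt R B m ++ [:: R]) v; rewrite -!catA.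
Qed.

(** Here the first peg R of the block steps out on the left; the last peg B is then
    left over on the right, and the hole traverses the m pairs BR in between. *)
Lemma shorten_sj m u v :
  plays ([:: move_s] ++ nseq m move_j)
    (u ++ None :: alt R B m.+1 ++ v) (u ++ R :: alt R B m ++ None :: B :: v).
Proof.
apply: plays_cat (play_s _ _) _.
rewrite /= -[B :: _ ++ _]alt_rotate_cat.
by have := play_jumps_j m (u ++ [:: R]) (B :: v); rewrite -!catA.
Qed.

Lemma shorten_SJ m u v :
  plays ([:: move_S] ++ nseq m move_J)
    (u ++ alt R B m.+1 ++ None :: v) (u ++ R :: None :: alt R B m ++ B :: v).
Proof.
apply: plays_cat (shorten_S _ _ _) _.
by have := play_jumps_J m (u ++ [:: R]) (B :: v); rewrite -!catA.
Qed.

(** * Phases *)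

Lemma nseqS_cat (x : cell) a s : nseq a.+1 x ++ s = nseq a x ++ x :: s.
Proof. by rewrite -addn1 nseqD -catA. Qed.

Lemma interleave N n : 2 * n <= N ->
  plays (\big[cat/[::]]_(1 <= k < n.+1)
           ([:: move_S] ++ nseq (2 * k - 1) move_j ++
            [:: move_s] ++ nseq (2 * k) move_J))
    (nseq N B ++ None :: nseq N R)
    (nseq (N - 2 * n) B ++ None :: alt R B (2 * n) ++ nseq (N - 2 * n) R).
Proof.
move=> nN.
(* Rounds are numbered from 1, so [P k] is the row before the k-th round. *)
pose P k := nseq (N - 2 * k.-1) B ++ None :: alt R B (2 * k.-1) ++ nseq (N - 2 * k.-1) R.
have -> : nseq N B ++ None :: nseq N R = P 1 by rewrite /P muln0 subn0.
rewrite -[X in plays _ _ X]/(P n.+1).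
apply: plays_big => // -[//|k] /andP[_ kn]; rewrite /P !succnK.
set m := 2 * k; have -> : 2 * k.+1 = m.+2 by rewrite /m; lia.
have -> : N - m = (N - m.+2).+2 by rewrite /m; lia.
move: (N - m.+2) => a; rewrite subn1 !nseqS_cat.
rewrite -[X in plays X]/(([:: move_S] ++ nseq m.+1 move_j) ++
                          ([:: move_s] ++ nseq m.+2 move_J)).
have := extend_Sj m (nseq a B ++ [:: B]) (R :: nseq a R); rewrite -!catA => Sj.
by apply: plays_cat Sj (extend_sJ m.+1 _ _).
Qed.

Lemma separate_even n :
  plays (\big[cat/[::]]_(1 <= k < n.+1)
           ([:: move_s] ++ nseq (2 * n - 2 * k + 1) move_j ++
            [:: move_S] ++ nseq (2 * n - 2 * k) move_J))
    (None :: alt R B (2 * n)) (nseq (2 * n) R ++ None :: nseq (2 * n) B).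
Proof.
pose P k := nseq (2 * k.-1) R ++ None :: alt R B (2 * n - 2 * k.-1) ++ nseq (2 * k.-1) B.
have -> : None :: alt R B (2 * n) = P 1 by rewrite /P muln0 subn0 cats0.
have -> : nseq (2 * n) R ++ None :: nseq (2 * n) B = P n.+1 by rewrite /P subnn.
apply: plays_big => // -[//|k] /andP[_ kn]; rewrite /P !succnK.
set m := 2 * n - 2 * k.+1; have -> : 2 * n - 2 * k = m.+2 by rewrite /m; lia.
have -> : 2 * k.+1 = (2 * k).+2 by lia.
move: (2 * k) => a; rewrite addn1 !nseqS_cat.
rewrite -[X in plays X]/(([:: move_s] ++ nseq m.+1 move_j) ++
                          ([:: move_S] ++ nseq m move_J)).
apply: plays_cat (shorten_sj _ _ _) _.
by have := shorten_SJ m (nseq a R ++ [:: R]) (B :: nseq a B); rewrite -!catA.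
Qed.

(** The row before the k-th round is R^a (BR)^m _ B^a with a = 2k-1 and
    m = 2n-2k: the first step S of the phase has already been made, and each
    round ends with the step that opens the next one. *)
Lemma separate_odd n : 0 < n ->
  plays (\big[cat/[::]]_(1 <= k < n)
           (nseq (2 * n - 2 * k) move_J ++ [:: move_s] ++
            nseq (2 * n - 2 * k - 1) move_j ++ [:: move_S]))
    (R :: alt B R (2 * n - 2) ++ [:: None; B])
    (nseq (2 * n - 1) R ++ None :: nseq (2 * n - 1) B).
Proof.
move=> n0.
pose P k := nseq (2 * k - 1) R ++ alt B R (2 * n - 2 * k) ++ None :: nseq (2 * k - 1) B.
rewrite -[R :: _ ++ _]/(P 1).
have -> : nseq (2 * n - 1) R ++ None :: nseq (2 * n - 1) B = P n by rewrite /P subnn.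
apply: plays_big => // k /andP[k0 kn]; rewrite /P.
set m := 2 * n - 2 * k.+1; have -> : 2 * n - 2 * k = m.+2 by rewrite /m; lia.
have -> : 2 * k.+1 - 1 = (2 * k - 1).+2 by lia.
move: (2 * k - 1) => a; rewrite subn1 !nseqS_cat.
apply: plays_cat (play_jumps_J _ _ _) _.
rewrite catA; apply: plays_cat (shorten_sj _ _ _) _.
by have := shorten_S m (nseq a R ++ [:: R]) (B :: nseq a B); rewrite -!catA.
Qed.

(** * Solving the puzzle *)

Lemma solves_plays N w :
  plays w (nseq N B ++ None :: nseq N R) (nseq N R ++ None :: nseq N B) -> solves N w.
Proof.
have rowE x y : layout N (nseq N x ++ None :: nseq N y) =
    [ffun i : 'I_(2 * N).+1 => if i < N then x else if val i == N then None else y].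
  apply/ffunP=> i; rewrite !ffunE nth_cat size_nseq nth_nseq.
  have [//|iN|->] := ltngtP i N; last by rewrite subnn.
  have -> : i - N = (i - N.+1).+1 by lia.
  by rewrite /= nth_nseq ifT //; have := ltn_ord i; lia.
move=> /(_ N) []; first by rewrite size_cat /= !size_nseq; lia.
by rewrite !rowE.
Qed.

Lemma size_big_cat (W : nat -> seq move) a b :
  size (\big[cat/[::]]_(a <= k < b) W k) = \sum_(a <= k < b) size (W k).
Proof. exact: (big_morph size (@size_cat _) erefl). Qed.

Theorem theorem1 (n N : nat) (hn : 0 < n) :
  (N = 2 * n ->
     let w :=
       (\big[cat/[::]]_(1 <= k < n.+1)
          ([:: move_S] ++ nseq (2 * k - 1) move_j ++
           [:: move_s] ++ nseq (2 * k) move_J)) ++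
       (\big[cat/[::]]_(1 <= k < n.+1)
          ([:: move_s] ++ nseq (2 * n - 2 * k + 1) move_j ++
           [:: move_S] ++ nseq (2 * n - 2 * k) move_J)) in
     size w = N ^ 2 + 2 * N /\ solves N w) /\
  (N = 2 * n - 1 ->
     let w :=
       (\big[cat/[::]]_(1 <= k < n)
          ([:: move_S] ++ nseq (2 * k - 1) move_j ++
           [:: move_s] ++ nseq (2 * k) move_J)) ++
       ([:: move_S] ++ nseq (2 * n - 1) move_j ++ [:: move_S]) ++
       (\big[cat/[::]]_(1 <= k < n)
          (nseq (2 * n - 2 * k) move_J ++ [:: move_s] ++
           nseq (2 * n - 2 * k - 1) move_j ++ [:: move_S])) in
     size w = N ^ 2 + 2 * N /\ solves N w).
Proof.
split=> NE w; split.
- rewrite size_cat !size_big_cat -big_split /=.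
  (* The k-th rounds of the two phases have 4n+4 moves together. *)
  rewrite (eq_big_nat _ _ (F2 := fun=> 4 * n + 4)) => [|k kn].
    by rewrite sum_nat_const_nat NE; lia.
  by rewrite !(size_cat, size_nseq) /= !(size_cat, size_nseq) /=; lia.
- apply: solves_plays; apply: plays_cat (interleave _ n _) _; first by rewrite NE.
  by rewrite NE subnn cats0; exact: separate_even.
- rewrite !size_cat !size_big_cat addnCA -big_split /=.
  (* Here such a pair of rounds has 4n+2 moves, and 2n+1 moves stand between
     the phases. *)
  rewrite (eq_big_nat _ _ (F2 := fun=> 4 * n + 2)) => [|k kn].
    by rewrite sum_nat_const_nat !(size_cat, size_nseq) /= NE; nia.
  by rewrite !(size_cat, size_nseq) /= !(size_cat, size_nseq) /=; lia.
- case: n => // n in hn NE w *.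
  (* The first phase now has [n] rounds and leaves one peg of either colour
     outside the block; the middle factor is S j^N, which absorbs these two,
     followed by the step that opens the second phase. *)
  apply: solves_plays; apply: plays_cat (interleave _ n _) _; first by lia.
  have -> : N - 2 * n = 1 by lia.
  have := separate_odd n.+1 isT; rewrite -NE => sep; apply: plays_cat sep.
  rewrite NE; have -> : 2 * n.+1 - 1 = (2 * n).+1 by lia.
  have -> : 2 * n.+1 - 2 = 2 * n by lia.
  rewrite catA; apply: plays_cat (extend_Sj _ [::] [::]) _.
  exact: (shorten_S _ [::] [::]).
Qed.
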